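(* Let $\Omega\subseteq\mathbb{C}^2$ be the unit ball with respect to some norm $\|\cdot\|_{\Omega}$ on $\mathbb{C}^2$, and suppose that $\Omega$ is Reinhardt. Then the complex Banach space $(\mathbb{C}^2,\|\cdot\|_{\Omega})$ has Property P if and only if the real Banach space $(\mathbb{R}^2,\|\cdot\|_{|\Omega|})$ has Property P.
   Context: A set $\Omega\subseteq\mathbb{C}^2$ is Reinhardt if $(z_1,z_2)\in\Omega$ implies $(e^{i\theta_1}z_1,e^{i\theta_2}z_2)\in\Omega$ for all $\theta_1,\theta_2\in\mathbb{R}$. Given $(\mathbb{C}^2,\|\cdot\|_\Omega)$ with Reinhardt unit ball $\Omega$, the real Banach space $(\mathbb{R}^2,\|\cdot\|_{|\Omega|})$ is defined by $\|(x,y)\|_{|\Omega|}=\|(x,y)\|_\Omega$ for $(x,y)\in\mathbb{R}^2\subseteq\mathbb{C}^2$; its unit ball is denoted $|\Omega|$. Let $\mathbb{K}=\mathbb{R}$ or $\mathbb{C}$ and let $X=(\mathbb{K}^n,\|\cdot\|_X)$. The dual $X^*$ is identified with $\mathbb{K}^n$ with norm $\|z\|_{X^*}=\sup\{|\sum_i z_i\overline{w_i}|:\|w\|_X\le 1\}$. For an $n\times n$ matrix $A$ over $\mathbb{K}$, $\|A\|_{X\to X^*}=\sup\{\|Ax\|_{X^*}:\|x\|_X\le1\}$, and $\|B\|_{X^*\to X}=\sup\{\|Bx\|_X:\|x\|_{X^*}\le1\}$. Write $A\ge0$ if $A$ is positive semidefinite (Hermitian in the complex case, real symmetric in the real case).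 Put $$\gamma(X):=\sup\{\langle A,B\rangle: A\ge 0,\ B\ge 0,\ \|A\|_{X\to X^*}\le1,\ \|B\|_{X^*\to X}\le1\},$$ where $A,B$ range over $n\times n$ matrices over $\mathbb{K}$ and $\langle A,B\rangle=\sum_{i,j}a_{ij}\overline{b_{ij}}$ is the Hilbert–Schmidt inner product. The space $X$ has Property P if and only if $\gamma(X)=1$. *)

(* Defs.v *)
From mathcomp Require Import all_boot all_order all_algebra.
From mathcomp Require Import complex.
From mathcomp Require Import boolp classical_sets reals trigo.
Set Implicit Arguments. Unset Strict Implicit. Unset Printing Implicit Defensive.
Import Order.TTheory GRing.Theory Num.Theory.
Local Open Scope classical_set_scope.
Local Open Scope ring_scope.
Local Open Scope sesquilinear_scope.

(* A field of scalars K with its conjugation and the inclusion of the reals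
   in K. Only the two instances below (K = R and K = C) are ever used; norms
   and suprema are valued in R, and [inR] compares them with elements of K. *)
Record scalars (R : realType) := Scalars {
  carrier :> numFieldType;
  conj : carrier -> carrier;
  inR : R -> carrier
}.
Arguments conj {R s}.
Arguments inR {R s}.

Definition real_scalars (R : realType) : scalars R :=
  @Scalars R R id id.

Definition complex_scalars (R : realType) : scalars R :=
  @Scalars R R[i] (@conjc R) (real_complex R).

Record normed_space (R : realType) (K : scalars R) (n : nat) := NormedSpace {
  norm :> 'cV[K]_n -> R;
  norm_ge0 : forall x, 0 <= norm x;
  norm_eq0 : forall x, norm x = 0 -> x = 0;
  norm_triangle : forall x y, norm (x + y) <= norm x + norm y;
  norm_scale : forall (a : K) x, inR (norm (a *: x)) = `|a| * inR (norm x)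
}.

Definition unit_ball (R : realType) (K : scalars R) (n : nat)
  (X : normed_space K n) : set 'cV[K]_n := [set x | X x <= 1].

(* For the norm N of a normed space, and for the dual norms obtained from it,
   the sets under the suprema in [dual_norm], [op_norm] and [gamma] are nonempty
   and, the dimension being finite, bounded; so [sup] is the least upper bound. *)
Definition dual_norm (R : realType) (K : scalars R) (n : nat)
  (N : 'cV[K]_n -> R) (z : 'cV[K]_n) : R :=
  sup [set r | exists2 w : 'cV[K]_n,
    N w <= 1 & inR r = `|\sum_i z i 0 * conj (w i 0)|].

Definition op_norm (R : realType) (K : scalars R) (n : nat)
  (N M : 'cV[K]_n -> R) (A : 'M[K]_n) : R :=
  sup [set M (A *m x) | x in [set x : 'cV[K]_n | N x <= 1]].

(* For K = C the order on K makes [0 <= z] mean that z is real and nonnegative. *)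
Definition psd (R : realType) (K : scalars R) (n : nat) (A : 'M[K]_n) : Prop :=
  A ^t conj = A /\
  forall x : 'cV[K]_n, 0 <= (x ^t conj *m A *m x) 0 0.

Definition hs_inner (R : realType) (K : scalars R) (n : nat) (A B : 'M[K]_n) : K :=
  \sum_i \sum_j A i j * conj (B i j).

(* The inner product of two Hermitian matrices is real, so the equation with
   [inR r] excludes no pair (A, B). *)
Definition gamma (R : realType) (K : scalars R) (n : nat)
  (X : normed_space K n) : R :=
  sup [set r | exists A B : 'M[K]_n,
    [/\ psd A, psd B,
        op_norm X (dual_norm X) A <= 1,
        op_norm (dual_norm X) X B <= 1
      & inR r = hs_inner A B]].

Definition property_P (R : realType) (K : scalars R) (n : nat)
  (X : normed_space K n) : Prop := gamma X = 1.

Definition expi (R : realType) (t : R) : R[i] := (cos t +i* sin t)%C.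

Definition reinhardt (R : realType) (n : nat) (Omega : set 'cV[R[i]]_n) : Prop :=
  forall (z : 'cV[R[i]]_n) (theta : 'I_n -> R),
    Omega z -> Omega (\col_i (expi (theta i) * z i 0)).

Section RealRestriction.
Variables (R : realType) (n : nat) (X : normed_space (complex_scalars R) n).

Let toC (x : 'cV[R]_n) : 'cV[R[i]]_n := map_mx (real_complex R) x.

Definition real_norm (x : 'cV[real_scalars R]_n) : R := X (toC x).

Lemma real_norm_ge0 x : 0 <= real_norm x.
Proof. exact: norm_ge0. Qed.

Lemma real_norm_eq0 x : real_norm x = 0 -> x = 0.
Proof.
move=> /norm_eq0 /matrixP h; apply/matrixP => i j.
by have := h i j; rewrite !mxE => -[].
Qed.

Lemma real_norm_triangle x y : real_norm (x + y) <= real_norm x + real_norm y.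
Proof. by rewrite /real_norm /toC map_mxD; exact: norm_triangle. Qed.

Lemma real_norm_scale (a : real_scalars R) x :
  inR (real_norm (a *: x)) = `|a| * inR (real_norm x) :> real_scalars R.
Proof.
rewrite /real_norm /toC map_mxZ /=.
have := norm_scale X (a%:C)%C (toC x); rewrite /= normc_def /= expr0n addr0 sqrtr_sqr.
by rewrite -rmorphM => /complexI.
Qed.

Definition real_restriction : normed_space (real_scalars R) n :=
  NormedSpace real_norm_ge0 real_norm_eq0 real_norm_triangle real_norm_scale.

End RealRestriction.

(* Main.v *)
Require Import Defs.
From mathcomp Require Import all_boot all_order all_algebra.
From mathcomp Require Import reals.
From mathcomp Require Import classical_sets trigo complex ring lra.

Set Implicit Arguments. Unset Strict Implicit. Unset Printing Implicit Defensive.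
Import Order.TTheory GRing.Theory Num.Theory.
Local Open Scope classical_set_scope.
Local Open Scope ring_scope.
Local Open Scope sesquilinear_scope.

(** The two gammas are equal, whether or not they are 1.  On a Reinhardt space
the norm of a vector depends only on the moduli of its coordinates and, by
convexity, increases with them ([absolute_monotone]); the dual norm inherits
both properties.  For matrices with nonnegative entries it follows that the
operator norm is the same over the complex and over the real scalars, because
replacing a vector by its entrywise moduli can only increase the norm of its
image.

Dimension 2 enters through signs and phases.  A positive semidefinite 2 x 2
matrix A has a single off-diagonal phase, so it factors as [A = D |A| D*] with D
diagonal unimodular and |A| the entrywise modulus ([psd2_phases]).  Hence |A|
is again positive semidefinite and has the same operator norms as A, while
passing from (A, B) to (|A|, |B|) can only increase the inner product
([hs_inner_le]).  Both suprema are thus attained, or approached, on pairs of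
real matrices with nonnegative entries, and such a pair is admissible over the
reals exactly when it is over the complex numbers.

The argument is uniform in the scalars.  [scalar_laws] records what it uses of
the conjugation and of the inclusion of the reals, and [gamma_transfer] states
that [gamma X] depends only on the real norm [p] such that [X x = p |x|].
Instantiated at K = C it is the theorem; its proof instantiates the lemmas on
moduli also at K = R, where D is a diagonal of signs. *)

(** * Suprema of mutually dominated sets *)

(** Without any boundedness assumption: the two down-closures coincide.  This
lets operator norms be compared without first showing that they are finite. *)
Lemma sup_eq_cofinal (R : realType) (A B : set R) :
  A `<=` down B -> B `<=` down A -> sup A = sup B.
Proof.
move=> AB BA; rewrite -(sup_down A) -(sup_down B); congr sup.
apply/seteqP; split=> x /downP[y /[swap] xy].
  by move=> /AB/downP[z Bz yz]; apply/downP; exists z; rewrite // (le_trans xy).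
by move=> /BA/downP[z Bz yz]; apply/downP; exists z; rewrite // (le_trans xy).
Qed.

(** * Monotone norms on real vectors *)

Definition monotone (R : realType) (n : nat)
    (p : 'cV[real_scalars R]_n -> R) : Prop :=
  forall x y : 'cV[real_scalars R]_n,
    (forall i, `|x i 0| <= `|y i 0|) -> p x <= p y.

Section MonotoneNorm.
Variables (R : realType) (n : nat).
Local Notation vec := 'cV[real_scalars R]_n.

Lemma monotone_eq (p : vec -> R) (x y : vec) :
  monotone p -> (forall i, `|x i 0| = `|y i 0|) -> p x = p y.
Proof.
move=> mp xy; apply/eqP; rewrite eq_le.
by rewrite !mp// => i; rewrite xy.
Qed.

Variable p : normed_space (real_scalars R) n.

Lemma real_norm_scaleE (a : R) (x : vec) : p (a *: x) = `|a| * p x.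
Proof. exact: (norm_scale p a x). Qed.

Hypothesis p_abs : forall x y : vec, (forall i, `|x i 0| = `|y i 0|) -> p x = p y.

(** Flipping the sign of the i-th coordinate of [y] gives [y'] of the same norm,
and up to signs [x] lies on the segment from [y] to [y']: convexity concludes. *)
Lemma absolute_shrink_coord (i : 'I_n) (x y : vec) :
  (forall j, j != i -> `|x j 0| = `|y j 0|) -> `|x i 0| <= `|y i 0| ->
  p x <= p y.
Proof.
move=> xy xyi.
have [y0|y0] := eqVneq (y i 0) 0.
  rewrite (@p_abs x y)// => j; have [->|] := eqVneq j i; last exact: xy.
  by apply/eqP; rewrite eq_le xyi y0 normr0 normr_ge0.
(* The weights (1 + t) / 2 and (1 - t) / 2 turn y i 0 and - y i 0 into t * y i 0. *)
pose t : R := `|x i 0| / `|y i 0|.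
have ny0 : `|y i 0| != 0 :> R by rewrite normr_eq0.
have t0 : 0 <= t by rewrite divr_ge0.
have t1 : t <= 1 by rewrite ler_pdivrMr ?normr_gt0// mul1r.
pose y' : vec := \col_j (if j == i then - y j 0 else y j 0).
have -> : p x = p (((1 + t) / 2) *: y + ((1 - t) / 2) *: y').
  apply: p_abs => j; rewrite !mxE; case: eqVneq => [->|/xy ->].
    have -> : (1 + t) / 2 * y i 0 + (1 - t) / 2 * - y i 0 = t * y i 0 :> R by field.
    by rewrite normrM ger0_norm// divfK.
  by congr Num.norm; rewrite -mulrDl; have -> : (1 + t) / 2 + (1 - t) / 2 = 1 :> R;
    [field | rewrite mul1r].
apply: le_trans (norm_triangle _ _ _) _.
have -> : p y = (1 + t) / 2 * p y + (1 - t) / 2 * p y by field.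
rewrite !real_norm_scaleE !ger0_norm; [|lra..].
rewrite (@p_abs y' y)// => j; rewrite mxE; case: eqP => // _.
by rewrite normrN.
Qed.

(** Pass from [y] to [x] by shrinking one coordinate at a time. *)
Lemma absolute_monotone : monotone p.
Proof.
move=> x y xy.
pose z k : vec := \col_j (if (j < k)%N then x j 0 else y j 0).
have zle k : (k <= n)%N -> p (z k) <= p y.
  elim: k => [|k IH] kn.
    by rewrite (@p_abs _ y)// => i; rewrite mxE ltn0.
  apply: le_trans (IH (ltnW kn)).
  apply: (@absolute_shrink_coord (Ordinal kn)) => [j jk|]; rewrite !mxE /=.
    rewrite ltnS leq_eqVlt; case: eqP => //= jk'.
    by move/eqP: jk; case; apply: val_inj.
  by rewrite ltnSn ltnn.
rewrite (@p_abs x (z n)) ?zle// => i; by rewrite mxE ltn_ord.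
Qed.

End MonotoneNorm.

(** * Scalars with a conjugation and a modulus *)

(** The properties shared by the real and the complex scalars.  The modulus is
[`|x|] read in [R], where norms and suprema live; [conj_fixed_real] says that
the scalars fixed by the conjugation are comparable with 0. *)
Record scalar_laws (R : realType) (K : scalars R) := ScalarLaws {
  modulus : K -> R;
  inR_modulus : forall x, inR (modulus x) = `|x|;
  inRD : forall r s : R, inR (r + s) = inR r + inR s :> K;
  inRM : forall r s : R, inR (r * s) = inR r * inR s :> K;
  inR_le : forall r s : R, (inR r <= inR s :> K) = (r <= s);
  conjD : forall x y : K, conj (x + y) = conj x + conj y;
  conjM : forall x y : K, conj (x * y) = conj x * conj y;
  conjI : forall x : K, conj (conj x) = x;
  conj_inR : forall r : R, conj (inR r) = inR r :> K;
  mul_conj : forall x : K, x * conj x = `|x| ^+ 2;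
  conj_fixed_real : forall x : K, conj x = x -> x \is Num.real
}.

Definition real_laws (R : realType) : scalar_laws (real_scalars R).
Proof.
apply: (@ScalarLaws R (real_scalars R) (fun x : R => `|x|)) => //=.
by move=> x; rewrite real_normK ?num_real// expr2.
Defined.

Definition complex_laws (R : realType) : scalar_laws (complex_scalars R).
Proof.
apply: (@ScalarLaws R (complex_scalars R) (@Normc.normc R)) => //=.
- by move=> r s; rewrite rmorphD.
- by move=> r s; rewrite rmorphM.
- by move=> r s; rewrite lecR.
- by move=> x y; rewrite rmorphD.
- by move=> x y; rewrite rmorphM.
- exact: conjcK.
- exact: conjc_real.
- by move=> x; rewrite sqr_normc.
- move=> [a b] [] /eqP; rewrite complex_real -subr_eq0 -opprD oppr_eq0.
  by rewrite -mulr2n mulrn_eq0.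
Defined.

Section Scalars.
Variables (R : realType) (K : scalars R) (L : scalar_laws K).
Local Notation mod := (modulus L).

Lemma inR_inj (r s : R) : inR r = inR s :> K -> r = s.
Proof. by move=> /eqP; rewrite eq_le !(inR_le L) -eq_le => /eqP. Qed.

Lemma inR0 : inR 0 = 0 :> K.
Proof. by apply: (@addrI _ (inR 0)); rewrite -(inRD L) !addr0. Qed.

Lemma inR1 : inR 1 = 1 :> K.
Proof.
have i0 : inR 1 != 0 :> K by rewrite -inR0; apply/eqP => /inR_inj/eqP; rewrite oner_eq0.
by apply: (mulfI i0); rewrite -(inRM L) !mulr1.
Qed.

Lemma inRN (r : R) : inR (- r) = - inR r :> K.
Proof. by apply: (@addrI _ (inR r)); rewrite -(inRD L) !subrr inR0. Qed.

Lemma inR_sum (I : finType) (F : I -> R) :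
  inR (\sum_i F i) = \sum_i inR (F i) :> K.
Proof. exact: (big_morph _ (inRD L) inR0). Qed.

Lemma inR_ge0 (r : R) : (0 <= inR r :> K) = (0 <= r).
Proof. by rewrite -inR0 (inR_le L). Qed.

Lemma normr_inR (r : R) : `|inR r| = inR `|r| :> K.
Proof.
case: (leP 0 r) => r0.
  by rewrite !ger0_norm// inR_ge0.
by rewrite (ltr0_norm r0) -normrN -inRN ger0_norm// inR_ge0 oppr_ge0 ltW.
Qed.

Lemma modulus_inR (r : R) : mod (inR r) = `|r|.
Proof. by apply: inR_inj; rewrite inR_modulus normr_inR. Qed.

Lemma modulus_ge0 (x : K) : 0 <= mod x.
Proof. by rewrite -inR_ge0 inR_modulus. Qed.

Lemma norm_modulus (x : K) : `|mod x| = mod x.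
Proof. by rewrite ger0_norm ?modulus_ge0. Qed.

Lemma norm_conj (x : K) : `|conj x| = `|x|.
Proof.
apply/eqP; rewrite -(@eqrXn2 _ 2)// -(mul_conj L) -(mul_conj L).
by rewrite (conjI L) mulrC.
Qed.

Lemma conj0 : conj 0 = 0 :> K.
Proof. by apply: normr0_eq0; rewrite norm_conj normr0. Qed.

Lemma conj1 : conj 1 = 1 :> K.
Proof. by have := mul_conj L 1; rewrite mul1r normr1 expr1n. Qed.

Lemma unimodularK (u : K) : `|u| = 1 -> u * conj u = 1.
Proof. by rewrite (mul_conj L) => ->; rewrite expr1n. Qed.

Lemma polar (z : K) : exists2 u : K, `|u| = 1 & z = u * inR (mod z).
Proof.
have [->|z0] := eqVneq z 0.
  by exists 1; rewrite ?normr1// inR_modulus normr0 mulr0.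
have nz0 : `|z| != 0 by rewrite normr_eq0.
exists (z / `|z|); first by rewrite normrM normfV normr_id divff.
by rewrite inR_modulus divfK.
Qed.

Lemma polar_conj (z : K) : exists2 u : K, `|u| = 1 & z * conj u = inR (mod z).
Proof.
have [u u1 zu] := polar z; exists u => //.
by rewrite {1}zu mulrAC unimodularK// mul1r.
Qed.

Lemma modulus_sum (I : finType) (F : I -> K) :
  mod (\sum_i F i) <= \sum_i mod (F i).
Proof.
rewrite -(inR_le L) inR_modulus inR_sum.
by under [leRHS]eq_bigr do rewrite inR_modulus; exact: ler_norm_sum.
Qed.

Lemma modulusM (x y : K) : mod (x * y) = mod x * mod y.
Proof. by apply: inR_inj; rewrite (inRM L) !inR_modulus normrM. Qed.

Definition modulus_mx (m n : nat) (A : 'M[K]_(m, n)) : 'M[real_scalars R]_(m, n) :=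
  map_mx mod A.

Section Dimension.
Variable n : nat.

(** Choosing the phases of [w] against those of [z] turns the pairing into a
sum of products of moduli, so the dual norm is a supremum over real data. *)
Lemma dual_norm_modulus (N : 'cV[K]_n -> R) (p : 'cV[real_scalars R]_n -> R)
    (z : 'cV[K]_n) :
  (forall x, N x = p (modulus_mx x)) -> monotone p ->
  dual_norm N z = sup [set r | exists2 w : 'cV[real_scalars R]_n,
    p w <= 1 & r = \sum_i mod (z i 0) * `|w i 0|].
Proof.
move=> Np mp; rewrite /dual_norm; apply: sup_eq_cofinal => r /= [w wN rE].
  apply/downP; exists (\sum_i mod (z i 0) * mod (w i 0)).
    exists (modulus_mx w); first by rewrite -Np.
    by apply: eq_bigr => i _; rewrite mxE norm_modulus.
  rewrite -(inR_le L) rE inR_sum (le_trans (ler_norm_sum _ _ _))//.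
  by apply: ler_sum => i _; rewrite (inRM L) !inR_modulus normrM norm_conj.
have [u u1 uz] := fin_all_exists2 (fun i => polar_conj (z i 0)).
apply/downP; exists r => //; exists (\col_i (inR `|w i 0| * u i)).
  rewrite Np (monotone_eq (y := w) mp)// => i.
  rewrite !mxE norm_modulus modulusM modulus_inR normr_id.
  have -> : mod (u i) = 1 by apply: inR_inj; rewrite inR_modulus u1 inR1.
  by rewrite mulr1.
rewrite rE; under [X in `|X|]eq_bigr => i _.
  rewrite mxE (conjM L) (conj_inR L) mulrCA uz -(inRM L) mulrC.
  over.
rewrite -inR_sum normr_inR ger0_norm// sumr_ge0// => i _.
by rewrite mulr_ge0 ?modulus_ge0.
Qed.

End Dimension.
End Scalars.

(** * Comparing norms and matrices with their entrywise moduli *)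

Lemma quad_formE (R : realType) (K : scalars R) (n : nat)
    (A : 'M[K]_n) (x : 'cV[K]_n) :
  (x ^t conj *m A *m x) 0 0 = \sum_i \sum_j conj (x i 0) * A i j * x j 0.
Proof.
rewrite mxE exchange_big; apply: eq_bigr => j _; rewrite mxE mulr_suml.
by apply: eq_bigr => i _; rewrite !mxE.
Qed.

Lemma psd_sym (R : realType) (K : scalars R) (n : nat)
    (A : 'M[K]_n) i j : psd A -> conj (A i j) = A j i.
Proof. by case=> /matrixP/(_ j i); rewrite !mxE. Qed.

Section Transfer.
Variables (R : realType) (K : scalars R) (L : scalar_laws K) (n : nat).
Local Notation mod := (modulus L).
Local Notation rvec := 'cV[real_scalars R]_n.

Lemma modulus_real (x : real_scalars R) : modulus (real_laws R) x = `|x|.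
Proof. by []. Qed.

Lemma monotone_modulus (p : rvec -> R) (x : rvec) :
  monotone p -> p x = p (modulus_mx (real_laws R) x).
Proof. by move=> mp; apply: monotone_eq => // i; rewrite mxE modulus_real normr_id. Qed.

Lemma dual_norm_transfer (N : 'cV[K]_n -> R) (p : rvec -> R) (z : 'cV[K]_n) :
  (forall x, N x = p (modulus_mx L x)) -> monotone p ->
  dual_norm N z = dual_norm p (modulus_mx L z).
Proof.
move=> Np mp; rewrite (dual_norm_modulus z Np mp).
rewrite (dual_norm_modulus (L := real_laws R) _ (fun x => monotone_modulus x mp) mp).
congr sup; apply/seteqP; split=> r [w pw ->]; exists w => //;
  by apply: eq_bigr => i _; rewrite mxE modulus_real norm_modulus.
Qed.

(** The dual unit ball must be bounded here, since [sup] is 0 on unbounded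
sets: testing monotonicity against the basis vectors bounds each coordinate
of a vector of the unit ball. *)
Lemma dual_norm_monotone (p : normed_space (real_scalars R) n) :
  monotone p -> monotone (dual_norm p).
Proof.
move=> mp x y xy.
have E := dual_norm_modulus (L := real_laws R) _ (fun z => monotone_modulus z mp) mp.
have p0 : p 0 <= 1.
  by have := real_norm_scaleE p 0 0; rewrite scale0r normr0 mul0r => ->.
have sum0 (z : rvec) : 0 = \sum_i modulus (real_laws R) (z i 0) * `|(0 : rvec) i 0|.
  by rewrite big1// => i _; rewrite mxE normr0 mulr0.
rewrite !E; apply: sup_le => [r [w pw ->]||].
- apply/downP; exists (\sum_i `|y i 0| * `|w i 0|); first by exists w.
  by apply: ler_sum => i _; apply: ler_wpM2r; [exact: normr_ge0|exact: xy].
- by exists 0, 0.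
split; first by exists 0, 0.
(* |w_i| p(e_i) = p(w_i e_i) <= p(w) <= 1, which gives the upper bound below. *)
pose e i : rvec := delta_mx i 0.
have pe i : 0 < p (e i).
  rewrite lt_neqAle norm_ge0 andbT eq_sym; apply/eqP => /norm_eq0 /matrixP/(_ i 0).
  by rewrite !mxE !eqxx => /eqP; rewrite oner_eq0.
exists (\sum_i (`|y i 0| : R) * (p (e i))^-1) => r [w pw ->].
apply: ler_sum => i _; apply: ler_wpM2l; first exact: normr_ge0.
rewrite -[leRHS]mul1r (@ler_pdivlMr R _ _ _ (pe i)) (le_trans _ pw)//.
rewrite -real_norm_scaleE; apply: mp => j; rewrite !mxE eqxx andbT.
by case: eqP => [->|_]; rewrite ?mulr1 ?mulr0 ?normr0.
Qed.

(** The phases [u] act on values and the phases [v] on arguments, and neither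
norm sees them; this leaves the modulus matrix, for which vectors with
nonnegative entries dominate all others. *)
Lemma op_norm_transfer (N M : 'cV[K]_n -> R) (p q : rvec -> R)
    (A : 'M[K]_n) (u v : 'I_n -> K) :
  (forall x, N x = p (modulus_mx L x)) -> monotone p ->
  (forall x, M x = q (modulus_mx L x)) -> monotone q ->
  (forall i, `|u i| = 1) -> (forall j, `|v j| = 1) ->
  (forall i j, A i j = u i * inR (mod (A i j)) * v j) ->
  op_norm N M A = op_norm p q (modulus_mx L A).
Proof.
move=> Np mp Mq mq u1 v1 AE.
have modu w : `|w| = 1 -> mod w = 1.
  by move=> w1; apply: (inR_inj L); rewrite inR_modulus w1 (inR1 L).
apply: sup_eq_cofinal => r /= [x xN <-]; apply/downP.
  exists (q (modulus_mx L A *m modulus_mx L x)).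
    by exists (modulus_mx L x) => //; rewrite /= -Np.
  rewrite Mq; apply: mq => i; rewrite !mxE norm_modulus.
  apply: (le_trans (modulus_sum L _)); rewrite ger0_norm; last first.
    by apply: sumr_ge0 => j _; rewrite !mxE mulr_ge0 ?modulus_ge0.
  by apply: ler_sum => j _; rewrite !mxE modulusM.
pose z : 'cV[K]_n := \col_j ((v j)^-1 * inR `|x j 0|).
have zx i : `|modulus_mx L z i 0| = `|x i 0|.
  rewrite !mxE norm_modulus modulusM modulus_inR normr_id modu ?mul1r//.
  by rewrite normfV v1 invr1.
exists (M (A *m z)).
  by exists z => //=; rewrite Np (monotone_eq mp zx).
rewrite Mq; apply: mq => i; rewrite !mxE norm_modulus.
have -> : \sum_j A i j * z j 0 = u i * inR (\sum_j mod (A i j) * `|x j 0|).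
  rewrite (inR_sum L) mulr_sumr; apply: eq_bigr => j _.
  rewrite mxE {1}AE (inRM L) -!mulrA [v j * _]mulrA divff ?mul1r//.
  by rewrite -normr_eq0 v1 oner_eq0.
rewrite modulusM modu// mul1r modulus_inR.
apply: (le_trans (ler_norm_sum _ _ _)); rewrite [leRHS]ger0_norm; last first.
  by apply: sumr_ge0 => j _; rewrite mulr_ge0 ?modulus_ge0.
by apply: ler_sum => j _; rewrite mxE normrM norm_modulus.
Qed.

Lemma hs_inner_le (A B : 'M[K]_n) :
  `|hs_inner A B| <= inR (hs_inner (modulus_mx L A) (modulus_mx L B)).
Proof.
rewrite /hs_inner (inR_sum L) (le_trans (ler_norm_sum _ _ _))//.
apply: ler_sum => i _; rewrite (inR_sum L) (le_trans (ler_norm_sum _ _ _))//.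
apply: ler_sum => j _.
by rewrite !mxE (inRM L) !inR_modulus normrM (norm_conj L).
Qed.

Definition inR_mx (A : 'M[real_scalars R]_n) : 'M[K]_n := map_mx inR A.

Lemma hs_inner_inR (A B : 'M[real_scalars R]_n) :
  hs_inner (inR_mx A) (inR_mx B) = inR (hs_inner A B).
Proof.
rewrite /hs_inner (inR_sum L); apply: eq_bigr => i _.
rewrite (inR_sum L); apply: eq_bigr => j _.
by rewrite !mxE (conj_inR L) (inRM L).
Qed.

Lemma psd_diag (A : 'M[K]_n) i : psd A -> 0 <= A i i.
Proof.
case=> _ /(_ (delta_mx i 0)); rewrite quad_formE (bigD1 i)//= (bigD1 i)//=.
rewrite !big1 ?addr0 => [|k /negbTE ki|j /negbTE ji]; last first.
- by rewrite [X in _ * X]mxE ji mulr0.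
- by apply: big1 => j _; rewrite mxE ki (conj0 L) !mul0r.
by rewrite !mxE !eqxx (conj1 L) mul1r mulr1.
Qed.

(** |A| is congruent to A by a diagonal unimodular matrix, so its quadratic form
at a real vector [x] is that of A at the vector with entries [u i * x i]. *)
Lemma psd_modulus (A : 'M[K]_n) (u : 'I_n -> K) :
  (forall i, `|u i| = 1) ->
  (forall i j, A i j = u i * inR (mod (A i j)) * conj (u j)) ->
  psd A -> psd (modulus_mx L A).
Proof.
move=> u1 AE psdA; split.
  apply/matrixP => i j; rewrite !mxE /= -(psd_sym i j psdA).
  by apply: (inR_inj L); rewrite !inR_modulus (norm_conj L).
move=> x; case: psdA => _ /(_ (\col_i (u i * inR (x i 0)))).
rewrite quad_formE => h; rewrite -(inR_ge0 L).
suff <- : \sum_i \sum_j conj ((\col_i (u i * inR (x i 0))) i 0) * A i j *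
    (\col_i (u i * inR (x i 0))) j 0
  = inR ((x ^t conj *m modulus_mx L A *m x) 0 0) :> K by [].
rewrite (quad_formE (modulus_mx L A)) (inR_sum L); apply: eq_bigr => i _.
rewrite (inR_sum L); apply: eq_bigr => j _.
rewrite !mxE [A i j in LHS]AE (conjM L) (conj_inR L) !(inRM L) /=.
have ui := unimodularK L (u1 i); have uj := unimodularK L (u1 j).
transitivity ((u i * conj (u i)) * (u j * conj (u j)) *
  (inR (x i 0) * inR (mod (A i j)) * inR (x j 0))); first by ring.
by rewrite ui uj !mul1r.
Qed.
End Transfer.

(** * Positive semidefinite 2 x 2 matrices *)

Lemma ord2_ind (P : 'I_2 -> Prop) : P 0 -> P 1 -> forall i, P i.
Proof.
move=> P0 P1 [[|[|//]] i2].
  by rewrite (_ : Ordinal i2 = 0)//; apply: val_inj.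
by rewrite (_ : Ordinal i2 = 1)//; apply: val_inj.
Qed.

Lemma sum_ord2 (V : nmodType) (F : 'I_2 -> V) : \sum_i F i = F 0 + F 1.
Proof. by rewrite !big_ord_recl big_ord0 addr0 (_ : lift _ _ = 1)//; apply: val_inj. Qed.

Section TwoByTwo.
Variables (R : realType) (K : scalars R) (L : scalar_laws K).
Local Notation mod := (modulus L).

(** Two rows leave one off-diagonal phase, which [u] can absorb in the first
coordinate.  For three rows or more, the phases of the off-diagonal entries
need not be of the form [u i * conj (u j)]. *)
Lemma psd2_phases (A : 'M[K]_2) : psd A ->
  exists2 u : 'I_2 -> K, (forall i, `|u i| = 1) &
    forall i j, A i j = u i * inR (mod (A i j)) * conj (u j).
Proof.
move=> psdA; have [w w1 Ew] := polar L (A 0 1).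
exists (fun i => if i == 0 then w else 1).
  by elim/ord2_ind; rewrite /= ?normr1.
have d i : inR (mod (A i i)) = A i i.
  by rewrite inR_modulus ger0_norm// (psd_diag L).
elim/ord2_ind; elim/ord2_ind => /=.
- by rewrite d mulrAC (unimodularK L)// mul1r.
- by rewrite (conj1 L) mulr1.
- rewrite mul1r -(psd_sym 0 1 psdA) {1}Ew (conjM L) (conj_inR L) mulrC.
  by congr (_ * _); rewrite !inR_modulus (norm_conj L).
- by rewrite d (conj1 L) mul1r mulr1.
Qed.

Lemma psd2_modulus (A : 'M[K]_2) : psd A -> psd (modulus_mx L A).
Proof. by move=> psdA; have [u u1 uA] := psd2_phases psdA; exact: psd_modulus uA psdA. Qed.

(** At [x] in K^2 the form is at least its value at the real vector
(|x_0|, - |x_1|), which makes the cross term as negative as possible. *)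
Lemma psd2_inR (A : 'M[real_scalars R]_2) :
  (forall i j, 0 <= A i j) -> psd A -> psd (inR_mx K A).
Proof.
move=> A0 psdA; have sA := psd_sym _ _ psdA; split.
  by apply/matrixP => i j; rewrite !mxE (conj_inR L) -(sA j i).
move=> x.
pose y : 'cV[real_scalars R]_2 := \col_i (if i == 0 then mod (x i 0) else - mod (x i 0)).
case: psdA => _ /(_ y); rewrite !quad_formE !sum_ord2.
rewrite !mxE /= -(sA 0 1) /= => h.
set t := conj (x 0 0) * x 1 0 + conj (x 1 0) * x 0 0.
have tr : t \is Num.real.
  apply: (conj_fixed_real L).
  by rewrite /t (conjD L) !(conjM L) !(conjI L) addrC; congr (_ + _); rewrite mulrC.
set n0 : K := inR (mod (x 0 0)); set n1 : K := inR (mod (x 1 0)).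
have /andP[tge _] : - (n0 * n1 + n0 * n1) <= t <= n0 * n1 + n0 * n1.
  rewrite -real_ler_norml// (le_trans (ler_normD _ _))// !normrM !(norm_conj L).
  by rewrite /n0 /n1 !inR_modulus [X in _ + X <= _]mulrC.
have e0 : x 0 0 * conj (x 0 0) = n0 * n0.
  by rewrite (mul_conj L) expr2 -(inR_modulus L).
have e1 : x 1 0 * conj (x 1 0) = n1 * n1.
  by rewrite (mul_conj L) expr2 -(inR_modulus L).
(* The gap between the form at x and its value at the real vector y. *)
have gap : 0 <= inR (A 0 1) * (t + (n0 * n1 + n0 * n1)) :> K.
  by rewrite mulr_ge0 ?(inR_ge0 L) ?A0// -[X in _ + X]opprK subr_ge0.
move: h; rewrite -(inR_ge0 L) => /addr_ge0/(_ gap).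
rewrite !(inRD L) !(inRM L) !(inRN L) -/n0 -/n1.
congr (_ <= _).
transitivity (inR (A 0 0) * (n0 * n0) + inR (A 1 1) * (n1 * n1)
  + inR (A 0 1) * t); first by ring.
by rewrite -e0 -e1 /t; ring.
Qed.

Lemma op_norm2_transfer (X : normed_space K 2)
    (p : normed_space (real_scalars R) 2) (A : 'M[K]_2) :
  (forall x, X x = p (modulus_mx L x)) -> monotone p -> psd A ->
  op_norm X (dual_norm X) A = op_norm p (dual_norm p) (modulus_mx L A) /\
  op_norm (dual_norm X) X A = op_norm (dual_norm p) p (modulus_mx L A).
Proof.
move=> Xp mp psdA; have [u u1 uA] := psd2_phases psdA.
have cu j : `|conj (u j)| = 1 by rewrite (norm_conj L).
have Xp' z := dual_norm_transfer z Xp mp.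
have mp' := dual_norm_monotone mp.
by split; apply: (op_norm_transfer (L := L) (u := u) (v := fun j => conj (u j))).
Qed.

End TwoByTwo.

(** * Gamma depends only on the real norm of the moduli *)

(** Each admissible pair (A, B), over K or over R, is dominated by the pair of
entrywise moduli, which is admissible over both. *)
Lemma gamma_transfer (R : realType) (K : scalars R) (L : scalar_laws K)
    (X : normed_space K 2) (p : normed_space (real_scalars R) 2) :
  (forall x, X x = p (modulus_mx L x)) -> monotone p -> gamma X = gamma p.
Proof.
move=> Xp mp; have pp x := monotone_modulus x mp.
apply: sup_eq_cofinal => r [A [B [psdA psdB]]].
  have [-> _] := op_norm2_transfer Xp mp psdA.
  have [_ ->] := op_norm2_transfer Xp mp psdB => nA nB rE.
  apply/downP; exists (hs_inner (modulus_mx L A) (modulus_mx L B)).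
    exists (modulus_mx L A), (modulus_mx L B); split=> //;
    exact: psd2_modulus.
  rewrite -(inR_le L) (le_trans _ (hs_inner_le L A B))// -rE normr_inR//.
  by rewrite (inR_le L) ler_norm.
have [-> _] := op_norm2_transfer pp mp psdA.
have [_ ->] := op_norm2_transfer pp mp psdB => nA nB rE.
set A' := modulus_mx (real_laws R) A; set B' := modulus_mx (real_laws R) B.
have abs_abs (C : 'M[real_scalars R]_2) :
    modulus_mx L (inR_mx K (modulus_mx (real_laws R) C)) = modulus_mx (real_laws R) C.
  by apply/matrixP => i j; rewrite !mxE modulus_inR modulus_real normr_id.
have psd' (C : 'M[real_scalars R]_2) : psd C ->
    psd (inR_mx K (modulus_mx (real_laws R) C)).
  move=> psdC; apply: (psd2_inR L); last exact: psd2_modulus.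
  by move=> i j; rewrite mxE modulus_real.
apply/downP; exists (hs_inner A' B').
  exists (inR_mx K A'), (inR_mx K B'); rewrite (hs_inner_inR L).
  have [-> _] := op_norm2_transfer Xp mp (psd' _ psdA).
  have [_ ->] := op_norm2_transfer Xp mp (psd' _ psdB).
  by rewrite !abs_abs; split=> //; exact: psd'.
have := hs_inner_le (real_laws R) A B; rewrite -rE /=; apply: le_trans.
exact: ler_norm.
Qed.

(** * Norms with a Reinhardt unit ball *)

Section Reinhardt.
Variables (R : realType) (n : nat) (X : normed_space (complex_scalars R) n).
Hypothesis hX : reinhardt (unit_ball X).

Lemma complex_norm_scaleE (r : R) (x : 'cV[R[i]]_n) :
  0 <= r -> X ((r%:C)%C *: x) = r * X x.
Proof.
move=> r0; apply: (inR_inj (complex_laws R)).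
rewrite norm_scale (inRM (complex_laws R)) ger0_norm //.
by rewrite -[0]/((0%:C)%C) lecR.
Qed.

(** Normalise [z] to the unit sphere, where the Reinhardt condition applies. *)
Lemma reinhardt_norm_le (z : 'cV[R[i]]_n) (theta : 'I_n -> R) :
  X (\col_i (expi (theta i) * z i 0)) <= X z.
Proof.
have [z0|z0] := eqVneq (X z) 0.
  rewrite (norm_eq0 z0) (_ : \col_i _ = 0) ?norm_ge0//.
  by apply/matrixP => i j; rewrite !mxE mulr0.
have Xz0 : 0 < X z by rewrite lt_neqAle eq_sym z0 norm_ge0.
have := hX (z := ((X z)^-1%:C)%C *: z) theta.
rewrite /unit_ball /= complex_norm_scaleE ?invr_ge0 ?norm_ge0// mulVf// => /(_ (lexx _)).
rewrite (_ : \col_i _ = ((X z)^-1%:C)%C *: \col_i (expi (theta i) * z i 0)).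
  by rewrite complex_norm_scaleE ?invr_ge0 ?norm_ge0// ler_pdivrMl// mulr1.
by apply/matrixP => i j; rewrite !mxE mulrCA.
Qed.

Lemma expi_polar (u : R[i]) : `|u| = 1 -> exists t, u = expi t.
Proof.
case: u => a b; rewrite normc_def /= => -[] /eqP.
rewrite -[X in _ == X]sqrtr1 eqr_sqrt ?addr_ge0 ?sqr_ge0// => /eqP ab.
have a1 : -1 <= a <= 1 by nra.
have sE : Num.sqrt (1 - a ^+ 2) = `|b| by rewrite -ab addrC addKr sqrtr_sqr.
have [b0|b0] := leP 0 b.
  exists (acos a); rewrite /expi acosK ?in_itv//= sin_acos// sE ger0_norm//.
exists (- acos a); rewrite /expi cosN sinN acosK ?in_itv//= sin_acos// sE ltr0_norm//.
by rewrite opprK.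
Qed.

(** A rotation by the arguments of the coordinates takes the vector of moduli
to [x], and the opposite rotation takes it back. *)
Lemma reinhardt_modulus (x : 'cV[R[i]]_n) :
  X x = real_restriction X (modulus_mx (complex_laws R) x).
Proof.
have [u u1 xu] := fin_all_exists2 (fun i => polar (complex_laws R) (x i 0)).
have [t ut] := fin_all_exists (fun i => expi_polar (u1 i)).
have expiN s : expi (- s) * expi s = 1 :> R[i].
  by rewrite /expi; simpc; rewrite cosN sinN mulNr opprK -!expr2 cos2Dsin2;
   congr (_ +i* _)%C; ring.
have xE : x = \col_i (expi (t i) * (map_mx (real_complex R)
    (modulus_mx (complex_laws R) x)) i 0).
  by apply/matrixP => i j; rewrite ord1 [LHS]xu !mxE ut.
apply/eqP; rewrite eq_le {1}xE reinhardt_norm_le /=.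
have := reinhardt_norm_le x (fun i => - t i); apply: le_trans.
rewrite le_eqVlt; apply/orP; left; apply/eqP; congr (X _).
apply/matrixP => i j; rewrite ord1 [x in RHS]xE !mxE mulrA expiN mul1r//.
Qed.

(** Signs are a special case of phases, so the real restriction is absolute. *)
Lemma reinhardt_monotone : monotone (real_restriction X).
Proof.
apply: absolute_monotone => x y xy.
pose toC (z : 'cV[R]_n) : 'cV[R[i]]_n := map_mx (real_complex R) z.
rewrite [LHS](reinhardt_modulus (toC x)) [RHS](reinhardt_modulus (toC y)).
congr (real_restriction X _); apply/matrixP => i j; rewrite ord1 !mxE.
by rewrite !(modulus_inR (complex_laws R)).
Qed.

End Reinhardt.

Theorem theorem1p1 (R : realType) (X : normed_space (complex_scalars R) 2)
    (hX : reinhardt (unit_ball X)) :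
  property_P X <-> property_P (real_restriction X).
Proof.
rewrite /property_P.
by rewrite (gamma_transfer (L := complex_laws R) (X := X) (p := real_restriction X)
  (reinhardt_modulus hX) (reinhardt_monotone hX)).
Qed.
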